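(* There exists a unique tensor rank function $r_*:\mathbf{T}\to\mathbf{Z}_+$ such that for every tensor rank function $r$ we have $r_*\le r$, i.e. $r_*(\mathcal{X})\le r(\mathcal{X})$ for all $\mathcal{X}\in\mathbf{T}$.
   Context: $\mathbf{Z}_+$ is the set of nonnegative integers and $\mathbf{N}$ the set of positive integers. For $m,n_1,\dots,n_m\in\mathbf{N}$, $\mathbf{T}(n_1,\dots,n_m)$ is the set of real $m$th order tensors $\mathcal{X}=(x_{i_1\cdots i_m})$ of dimension $n_1\times\cdots\times n_m$; $\mathbf{CT}(m,n)$ is the case $n_1=\cdots=n_m=n$; $\mathbf{T}$ is the set of all real tensors (all orders $m\ge1$, all dimensions). A tensor $\mathcal{X}\in\mathbf{T}(n_1,\dots,n_m)$ is rank-one if $\mathcal{X}=\mathbf{x}^{(1)}\circ\cdots\circ\mathbf{x}^{(m)}$ (outer product) with nonzero $\mathbf{x}^{(i)}\in\mathbb{R}^{n_i}$. The identity tensor $\mathcal{I}_{m,n}\in\mathbf{CT}(m,n)$ has entries $1$ when $i_1=\cdots=i_m$ and $0$ otherwise. A subtensor of $\mathcal{X}\in\mathbf{T}(n_1,\dots,n_m)$ is a tensor of the same order $m$ obtained by choosing nonempty index sets $T_l\subseteq\{1,\dots,n_l\}$, $l=1,\dots,m$, and restricting $\mathcal{X}$ to $T_1\times\cdots\times T_m$; it is an element of $\mathbf{T}(|T_1|,\dots,|T_m|)$. A function $r:\mathbf{T}\to\mathbf{Z}_+$ is a tensor rank function if: (1) $r(\mathcal{X})=0$ iff $\mathcal{X}$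 is a zero tensor, and $r(\mathcal{X})=1$ iff $\mathcal{X}$ is a rank-one tensor; (2) $r(\mathcal{I}_{m,n})=n$ for all $m,n\in\mathbf{N}$ with $m\ge2$; (3) for $\mathcal{X}\in\mathbf{T}(n_1,n_2,1,\dots,1)$ (order at least $2$), $r(\mathcal{X})$ equals the matrix rank of the $n_1\times n_2$ matrix corresponding to $\mathcal{X}$; (4) $r(\alpha\mathcal{X})=r(\mathcal{X})$ for every tensor $\mathcal{X}$ and real $\alpha\ne0$; (5) $r(\mathcal{Y})=r(\mathcal{X})$ whenever $\mathcal{Y}$ is obtained from $\mathcal{X}$ by permuting its modes, i.e. $\sigma$ is a permutation of the $m$ coordinates, $\mathcal{Y}$ has dimensions $\sigma(n_1,\dots,n_m)$, and the entry of $\mathcal{Y}$ at position $\sigma(i_1,\dots,i_m)$ is $x_{i_1\cdots i_m}$; (6) $r(\mathcal{Y})\le r(\mathcal{X})$ whenever $\mathcal{Y}$ is a subtensor of $\mathcal{X}$. *)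

(* Defs.v *)
From mathcomp Require Import all_boot all_order perm all_algebra.
From mathcomp Require Import reals.

Set Implicit Arguments.
Unset Strict Implicit.
Unset Printing Implicit Defensive.

Import GRing.Theory.
Local Open Scope ring_scope.

(* Modes and indices are numbered from 0. *)
Definition tensor_index (m : nat) (n : 'I_m -> nat) : finType :=
  {dffun forall k : 'I_m, 'I_(n k)}.

Definition tensor (R : realType) (m : nat) (n : 'I_m -> nat) :=
  {ffun tensor_index n -> R}.

(* The set of all real tensors. The positivity of the order and of the
   dimensions is part of the type, so that a function on [any_tensor R] has no
   values outside the domain of a rank function. *)
Record any_tensor (R : realType) := AnyTensor {
  order : nat;
  dim : 'I_order -> nat;
  order_gt0 : (0 < order)%N;
  dim_gt0 : forall k, (0 < dim k)%N;
  entries : tensor R dim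
}.

Definition outer_product (R : realType) (m : nat) (n : 'I_m -> nat)
    (x : forall k : 'I_m, 'rV[R]_(n k)) : tensor R n :=
  [ffun i : tensor_index n => \prod_(k < m) x k 0 (i k)].

Definition rank_one (R : realType) (m : nat) (n : 'I_m -> nat)
    (X : tensor R n) : Prop :=
  exists x : forall k : 'I_m, 'rV[R]_(n k),
    (forall k, x k != 0) /\ X = outer_product x.

Definition identity_tensor (R : realType) (m n : nat) :
    tensor R (fun _ : 'I_m => n) :=
  [ffun i : tensor_index (fun _ : 'I_m => n) =>
     if [forall k : 'I_m, forall l : 'I_m, i k == i l] then 1 else 0].

Definition scale_tensor (R : realType) (m : nat) (n : 'I_m -> nat) (a : R)
    (X : tensor R n) : tensor R n :=
  [ffun i : tensor_index n => a * X i].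

Definition mode0 (m : nat) : 'I_m.+2 := ord0.
Definition mode1 (m : nat) : 'I_m.+2 := lift ord0 ord0.

(* For n = (n_1, n_2, 1, ..., 1) with positive n_1 and n_2, an index is
   determined by its first two components, which are arbitrary; hence exactly
   one matrix corresponds to X. *)
Definition corresponding_matrix (R : realType) (m : nat) (n : 'I_m.+2 -> nat)
    (X : tensor R n) (A : 'M[R]_(n (mode0 m), n (mode1 m))) : Prop :=
  forall i : tensor_index n, A (i (mode0 m)) (i (mode1 m)) = X i.

Definition permute_index (m : nat) (n : 'I_m -> nat) (s : {perm 'I_m})
    (i : tensor_index n) : tensor_index (fun k => n (s k)) :=
  [ffun k : 'I_m => i (s k)].

(* [permute_index s] is a bijection, so X and s determine Y. *)
Definition mode_permutation (R : realType) (m : nat) (n : 'I_m -> nat)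
    (s : {perm 'I_m}) (X : tensor R n) (Y : tensor R (fun k => n (s k))) :
    Prop :=
  forall i : tensor_index n, Y (permute_index s i) = X i.

(* [enum_val] lists the elements of T l in increasing order. *)
Definition subtensor (R : realType) (m : nat) (n : 'I_m -> nat)
    (T : forall l : 'I_m, {set 'I_(n l)}) (X : tensor R n) :
    tensor R (fun l => #|T l|) :=
  [ffun j : tensor_index (fun l => #|T l|) =>
     X [ffun l : 'I_m => enum_val (j l)]].

Lemma subtensor_dim_gt0 (m : nat) (n : 'I_m -> nat)
    (T : forall l : 'I_m, {set 'I_(n l)}) :
  (forall l, T l != set0) -> forall l, (0 < #|T l|)%N.
Proof. by move=> hT l; rewrite card_gt0. Qed.

Record tensor_rank_function (R : realType) (r : any_tensor R -> nat) :
    Prop := TensorRankFunction {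
  rank_eq0 : forall X : any_tensor R, r X = 0%N <-> entries X = 0;
  rank_eq1 : forall X : any_tensor R, r X = 1%N <-> rank_one (entries X);
  rank_identity : forall (m n : nat) (hm : (0 < m)%N)
      (hn : forall _ : 'I_m, (0 < n)%N),
    (2 <= m)%N -> r (AnyTensor hm hn (identity_tensor R m n)) = n;
  rank_matrix : forall (m : nat) (n : 'I_m.+2 -> nat) (hm : (0 < m.+2)%N)
      (hn : forall k, (0 < n k)%N) (X : tensor R n)
      (A : 'M[R]_(n (mode0 m), n (mode1 m))),
    (forall k : 'I_m.+2, (2 <= k)%N -> n k = 1%N) ->
    corresponding_matrix X A -> r (AnyTensor hm hn X) = \rank A;
  rank_scale : forall (X : any_tensor R) (a : R), a != 0 ->
    r (AnyTensor (order_gt0 X) (@dim_gt0 R X)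
         (scale_tensor a (entries X))) = r X;
  rank_permute : forall (m : nat) (n : 'I_m -> nat) (s : {perm 'I_m})
      (hm : (0 < m)%N) (hn : forall k, (0 < n k)%N)
      (hns : forall k, (0 < n (s k))%N)
      (X : tensor R n) (Y : tensor R (fun k => n (s k))),
    mode_permutation X Y -> r (AnyTensor hm hns Y) = r (AnyTensor hm hn X);
  rank_subtensor : forall (m : nat) (n : 'I_m -> nat) (hm : (0 < m)%N)
      (hn : forall k, (0 < n k)%N) (X : tensor R n)
      (T : forall l : 'I_m, {set 'I_(n l)})
      (hT : forall l, T l != set0),
    (r (AnyTensor hm (subtensor_dim_gt0 hT) (subtensor T X))
       <= r (AnyTensor hm hn X))%N
}.

(* Main.v *)
Require Import Defs.
From mathcomp Require Import all_boot all_order all_algebra.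
From mathcomp Require Import reals.
From mathcomp Require Import perm boolp.

(** The conditions on a tensor rank function either fix the value [r X], or
    compare [r X] with [r Y] for related tensors; hence they pass to the pointwise
    minimum of all tensor rank functions. The only point left is that
    tensor rank functions exist: the least number of rank-one summands (CP rank)
    is one. Lower bounds for it come from matrices: a slice of a sum of [r]
    rank-one tensors in which the first index depends only on the row, and the
    others only on the column, is a product of a [p x r] and an [r x q]
    matrix. *)

Set Implicit Arguments.
Unset Strict Implicit.
Unset Printing Implicit Defensive.

Import GRing.Theory.
Local Open Scope ring_scope.

(* The factors are functions on [nat], not row vectors of size [n k], so that
   modes can be permuted without type casts. *)
Definition cp_sum (R : realType) (m : nat) (n : 'I_m -> nat) (X : tensor R n)
    (r : nat) : Prop :=
  exists x : 'I_r -> 'I_m -> nat -> R,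
    forall i : tensor_index n, X i = \sum_(j < r) \prod_(k < m) x j k (i k).

Section TensorRank.
Variable R : realType.

(** * Finite sums of rank-one tensors *)

Lemma cp_sum0P (m : nat) (n : 'I_m -> nat) (X : tensor R n) :
  cp_sum X 0 <-> X = 0.
Proof.
split=> [[x hx]|->]; first by apply/ffunP => i; rewrite hx big_ord0 ffunE.
by exists (fun _ _ _ => 0) => i; rewrite big_ord0 ffunE.
Qed.

Lemma rank_one_neq0 (m : nat) (n : 'I_m -> nat) (X : tensor R n) :
  rank_one X -> X <> 0.
Proof.
case=> x [xn0 ->] /ffunP outer0.
have ex k : exists a, x k 0 a != 0.
  by have /rV0Pn := xn0 k.
pose i : tensor_index n := [ffun k => xchoose (ex k)].
have /eqP := outer0 i; rewrite !ffunE; apply/negP/prodf_neq0 => k _.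
by rewrite ffunE; exact: xchooseP (ex k).
Qed.

(** [rank_one] asks for nonzero factors, while a term of [cp_sum] may have zero ones. A zero factor
    annihilates the whole product, and nonzero factors give a nonzero entry, so [X <> 0] accounts
    for the difference. *)
Lemma rank_oneP (m : nat) (n : 'I_m -> nat) (X : tensor R n) :
  rank_one X <-> cp_sum X 1 /\ X <> 0.
Proof.
split=> [X1|[[x hx] X0]].
  split; last exact: rank_one_neq0.
  case: X1 => y [_ ->].
  exists (fun _ k a => if insub a is Some b then y k 0 b else 0) => i.
  by rewrite big_ord1 ffunE; apply: eq_bigr => k _; rewrite valK.
have prodE i : X i = \prod_(k < m) x 0 k (i k) by rewrite hx big_ord1.
exists (fun k => \row_a x 0 k a); split; last first.
  by apply/ffunP => i; rewrite ffunE prodE; apply: eq_bigr => k _; rewrite mxE.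
move=> k; apply: contra_notN X0 => /eqP /rowP xk0; apply/ffunP => i.
rewrite ffunE prodE (bigD1 k) //=.
by have := xk0 (i k); rewrite !mxE => ->; rewrite mul0r.
Qed.

(** Decomposition into entries times outer products of basis vectors, one term per index. The entry
    is absorbed into the factor of mode [ord0], which exists as [0 < m]. *)
Lemma cp_sum_card (m : nat) (n : 'I_m -> nat) (X : tensor R n) :
  (0 < m)%N -> cp_sum X #|tensor_index n|.
Proof.
case: m n X => // m n X _.
pose e (j : 'I_#|tensor_index n|) : tensor_index n := enum_val j.
pose x j (k : 'I_m.+1) (a : nat) : R :=
  (if k == ord0 then X (e j) else 1) * (a == e j k)%:R.
exists x => i; have eK : e (enum_rank i) = i by exact: enum_rankK.
rewrite (bigD1 (enum_rank i)) //= [X in _ + X]big1 ?addr0.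
  rewrite big_ord_recl /x eK !eqxx mulr1 big1 ?mulr1 // => k _.
  by rewrite eqxx mul1r.
move=> j ji; have /existsP [k ik] : [exists k, i k != e j k].
  rewrite -negb_forall; apply: contra ji => /forallP ie.
  apply/eqP/enum_val_inj; rewrite -/(e _) -/(e (enum_rank i)) eK.
  by apply/ffunP => k; apply/esym/eqP.
by rewrite (bigD1 k) //= /x val_eqE (negbTE ik) mulr0 mul0r.
Qed.

Lemma cp_sum_scale (m : nat) (n : 'I_m -> nat) (X : tensor R n) (a : R) r :
  (0 < m)%N -> cp_sum X r -> cp_sum (scale_tensor a X) r.
Proof.
case: m n X => // m n X _ [x hx].
exists (fun j k b => (if k == ord0 then a else 1) * x j k b) => i.
rewrite ffunE hx mulr_sumr; apply: eq_bigr => j _.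
rewrite !big_ord_recl /= mulrA; congr (_ * _).
by apply: eq_bigr => k _; rewrite mul1r.
Qed.

Lemma cp_sum_permute (m : nat) (n : 'I_m -> nat) (s : {perm 'I_m})
    (X : tensor R n) (Y : tensor R (fun k => n (s k))) r :
  mode_permutation X Y -> cp_sum X r <-> cp_sum Y r.
Proof.
move=> XY; split=> -[x hx].
  exists (fun j k => x j (s k)) => i.
  (* [mode_permutation] describes [Y] only at permuted indices, so [permute_index s] has to be shown
     surjective. The cast is due to [n (s ((s^-1) k))] being only provably equal to [n k]. *)
  have [i' ->] : exists i', i = permute_index s i'.
    exists [ffun k => cast_ord (congr1 n (permKV s k)) (i ((s^-1)%g k))].
    have ival k l : k = l -> val (i k) = val (i l) by move->.
    by apply/ffunP => k; apply: val_inj; rewrite !ffunE; apply: ival;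
      rewrite permK.
  rewrite XY hx; apply: eq_bigr => j _.
  by rewrite (reindex_inj (@perm_inj _ s)); apply: eq_bigr => k _; rewrite ffunE.
exists (fun j k => x j ((s^-1)%g k)) => i; rewrite -XY hx.
apply: eq_bigr => j _; rewrite [RHS](reindex_inj (@perm_inj _ s)).
by apply: eq_bigr => k _; rewrite permK ffunE.
Qed.

Lemma cp_sum_subtensor (m : nat) (n : 'I_m -> nat) (X : tensor R n)
    (T : forall l : 'I_m, {set 'I_(n l)}) r :
  cp_sum X r -> cp_sum (subtensor T X) r.
Proof.
case=> x hx.
exists (fun j k a =>
  if insub a is Some b then x j k (enum_val (b : 'I_#|T k|)) else 0) => i.
rewrite ffunE hx; apply: eq_bigr => j _; apply: eq_bigr => k _.
by rewrite ffunE valK.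
Qed.

(** * Matrix slices, identity tensors and matrices *)

Lemma mxrank_slice (m : nat) (n : 'I_m.+1 -> nat) (X : tensor R n) r p q
    (A : 'M[R]_(p, q)) (f : 'I_p -> 'I_q -> tensor_index n)
    (u : 'I_p -> 'I_(n ord0)) (v : forall k, 'I_q -> 'I_(n (lift ord0 k))) :
    (forall a b, A a b = X (f a b)) -> (forall a b, f a b ord0 = u a) ->
    (forall a b k, f a b (lift ord0 k) = v k b) ->
  cp_sum X r -> (\rank A <= r)%N.
Proof.
move=> AX fu fv [x hx].
have -> : A = (\matrix_(a < p, j < r) x j ord0 (u a)) *m
    (\matrix_(j < r, b < q) \prod_(k < m) x j (lift ord0 k) (v k b)).
  apply/matrixP => a b; rewrite AX hx mxE; apply: eq_bigr => j _.
  rewrite !mxE big_ord_recl fu; congr (_ * _).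
  by apply: eq_bigr => k _; rewrite fv.
exact: leq_trans (mxrankM_maxl _ _) (rank_leq_col _).
Qed.

Lemma cp_sum_identity (m n : nat) :
  (0 < m)%N -> cp_sum (identity_tensor R m n) n.
Proof.
case: m => // m _; exists (fun j k a => (a == val j)%:R) => i; rewrite ffunE.
case: ifPn => [/forallP icst|].
  rewrite (bigD1 (i ord0)) //= !big1 ?addr0 // => [j ji|k _].
    by rewrite big_ord_recl val_eqE eq_sym (negbTE ji) mul0r.
  by rewrite val_eqE (forallP (icst k) ord0).
rewrite negb_forall => /existsP [k]; rewrite negb_forall => /existsP [l kl].
(* Since [i k] and [i l] differ, at least one of them differs from [j], and its factor is 0. *)
apply/esym/big1 => j _; have [kj|kj] := eqVneq (i k) j.
  by rewrite (bigD1 l) //= val_eqE -kj eq_sym (negbTE kl) mul0r.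
by rewrite (bigD1 k) //= val_eqE (negbTE kj) mul0r.
Qed.

(** Setting the first index to [a] and all others to [b] gives the identity matrix of size [n] as a
    slice; with at least two modes, [a] and [b] are compared. *)
Lemma cp_sum_identity_ge (m n r : nat) :
  (2 <= m)%N -> cp_sum (identity_tensor R m n) r -> (n <= r)%N.
Proof.
case: m => [//|[//|m]] _; rewrite -[leqLHS](mxrank1 R).
pose f (a b : 'I_n) : tensor_index (fun _ : 'I_m.+2 => n) :=
  [ffun k => if k == ord0 then a else b].
apply: (mxrank_slice (f := f) (u := id) (v := fun=> id)) => [a b|a b|a b k].
- rewrite mxE ffunE -[LHS]/((a == b)%:R); have [->|ab] := eqVneq a b.
    by case: ifPn => // /forallP []k; apply/forallP => l; rewrite !ffunE !if_same.
  case: ifP => // /forallP /(_ ord0) /forallP /(_ (lift ord0 ord0)).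
  by rewrite !ffunE (negbTE ab).
- by rewrite ffunE.
- by rewrite ffunE.
Qed.

Section Matrix.
Variables (m : nat) (n : 'I_m.+2 -> nat) (hn : forall k, (0 < n k)%N).
Variables (X : tensor R n) (A : 'M[R]_(n (mode0 m), n (mode1 m))).
Hypothesis XA : corresponding_matrix X A.

Lemma cp_sum_mxrank : cp_sum X (\rank A).
Proof.
(* The rank factorization [col_base A *m row_base A] supplies the factors of the first two modes. By
   [XA] the entries do not depend on the other indices, whose factors are 1. The default of [insubd]
   is never reached at an actual index. *)
pose x (j : 'I_(\rank A)) (k : 'I_m.+2) (a : nat) : R :=
  if k == mode0 m then col_base A (insubd (Ordinal (hn _)) a) j
  else if k == mode1 m then row_base A j (insubd (Ordinal (hn _)) a) else 1.
exists x => i; rewrite -XA -{1}(mulmx_base A) mxE; apply: eq_bigr => j _.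
by rewrite !big_ord_recl /x /= !valKd big1 ?mulr1.
Qed.

Lemma mxrank_cp_sum r : cp_sum X r -> (\rank A <= r)%N.
Proof.
(* [A] is the slice of [X] at the indices [(a, b, 0, ..., 0)]. In [v] the modes are shifted by one,
   so [ord0] stands for [mode1 m]. *)
pose v (k : 'I_m.+1) (b : 'I_(n (mode1 m))) : 'I_(n (lift ord0 k)) :=
  insubd (Ordinal (hn _)) (if k == ord0 then val b else 0%N).
pose f a b : tensor_index n := [ffun k =>
  insubd (Ordinal (hn k)) (if k == mode0 m then val (a : 'I_(n (mode0 m)))
    else if k == mode1 m then val (b : 'I_(n (mode1 m))) else 0%N)].
apply: (mxrank_slice (f := f) (u := id) (v := v)) => [a b|a b|a b k].
- by rewrite -XA !ffunE /= !valKd.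
- by rewrite ffunE /= valKd.
- by rewrite ffunE /v /=; congr insubd.
Qed.

End Matrix.

(** * The CP rank is a tensor rank function *)

Lemma ex_cp_sum (X : any_tensor R) : exists r, `[< cp_sum (entries X) r >].
Proof. by eexists; apply/asboolP/cp_sum_card; case: X. Qed.

Definition cp_rank (X : any_tensor R) : nat := ex_minn (ex_cp_sum X).

Lemma cp_rankP (X : any_tensor R) : cp_sum (entries X) (cp_rank X).
Proof. by rewrite /cp_rank; case: ex_minnP => r /asboolP. Qed.

Lemma cp_rank_le (X : any_tensor R) r :
  cp_sum (entries X) r -> (cp_rank X <= r)%N.
Proof.
by move=> Xr; rewrite /cp_rank; case: ex_minnP => s _; apply; apply/asboolP.
Qed.

Lemma cp_rank_tensor_rank : tensor_rank_function cp_rank.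
Proof.
have rk0 X : cp_rank X = 0%N <-> entries X = 0.
  rewrite -cp_sum0P; split=> [X0|/cp_rank_le]; last by rewrite leqn0 => /eqP.
  by rewrite -X0; exact: cp_rankP.
have le_scale X a : (cp_rank (AnyTensor (Defs.order_gt0 X) (@dim_gt0 R X)
    (scale_tensor a (entries X))) <= cp_rank X)%N.
  by apply/cp_rank_le/cp_sum_scale/cp_rankP; case: X.
split=> //.
- move=> X; rewrite rank_oneP -rk0; split=> [X1|[/cp_rank_le X1 X0]].
    by have := cp_rankP X; rewrite X1; split.
  by apply/eqP; rewrite eqn_leq X1 lt0n; apply/eqP.
- move=> m n hm hn m2; apply/eqP; rewrite eqn_leq.
  apply/andP; split; first exact/cp_rank_le/cp_sum_identity.
  exact: cp_sum_identity_ge m2 (cp_rankP (AnyTensor _ _ _)).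
- move=> m n hm hn X A _ XA; apply/eqP; rewrite eqn_leq.
  apply/andP; split; first exact/cp_rank_le/cp_sum_mxrank.
  exact: mxrank_cp_sum XA _ (cp_rankP (AnyTensor _ _ _)).
- move=> X a a0; apply/eqP; rewrite eqn_leq le_scale /=.
  (* Scaling back by [a^-1] gives the converse inequality. *)
  apply: leq_trans (le_scale (AnyTensor _ _ _) a^-1); rewrite /=.
  have -> // : scale_tensor a^-1 (scale_tensor a (entries X)) = entries X.
    by apply/ffunP => i; rewrite !ffunE mulKf.
  by case: X.
- move=> m n s hm hn hns X Y /cp_sum_permute XY; apply/eqP.
  by rewrite eqn_leq; apply/andP; split; apply/cp_rank_le/XY;
    exact: (cp_rankP (AnyTensor _ _ _)).
- move=> m n hm hn X T hT; apply/cp_rank_le/cp_sum_subtensor.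
  exact: (cp_rankP (AnyTensor _ _ _)).
Qed.

(** * The pointwise minimum of all tensor rank functions *)

Lemma ex_tensor_rank (X : any_tensor R) :
  exists k, `[< exists2 r, tensor_rank_function r & r X = k >].
Proof.
by exists (cp_rank X); apply/asboolP; exists cp_rank => //;
  exact: cp_rank_tensor_rank.
Qed.

Definition min_tensor_rank (X : any_tensor R) : nat := ex_minn (ex_tensor_rank X).

Lemma min_tensor_rankP (X : any_tensor R) :
  exists2 r, tensor_rank_function r & r X = min_tensor_rank X.
Proof. by rewrite /min_tensor_rank; case: ex_minnP => k /asboolP. Qed.

Lemma min_tensor_rank_le (r : any_tensor R -> nat) (X : any_tensor R) :
  tensor_rank_function r -> (min_tensor_rank X <= r X)%N.
Proof.
move=> hr; rewrite /min_tensor_rank; case: ex_minnP => k _; apply.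
by apply/asboolP; exists r.
Qed.

(** The function attaining the minimum may vary with the tensor; it is enough to take one that
    attains it at [Y] and evaluate it at [X]. *)
Lemma min_tensor_rank_homo (X Y : any_tensor R) :
    (forall r, tensor_rank_function r -> (r X <= r Y)%N) ->
  (min_tensor_rank X <= min_tensor_rank Y)%N.
Proof.
move=> leXY; have [r hr <-] := min_tensor_rankP Y.
exact: leq_trans (min_tensor_rank_le X hr) (leXY r hr).
Qed.

Lemma min_tensor_rank_cst (X Y : any_tensor R) :
    (forall r, tensor_rank_function r -> r X = r Y) ->
  min_tensor_rank X = min_tensor_rank Y.
Proof.
by move=> eqXY; apply/eqP; rewrite eqn_leq !min_tensor_rank_homo // => r /eqXY ->.
Qed.

Lemma min_tensor_rank_tensor_rank : tensor_rank_function min_tensor_rank.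
Proof.
split.
- move=> X; split=> [X0|X0].
    by have [r hr] := min_tensor_rankP X; rewrite X0 => /(rank_eq0 hr).
  by have [r hr <-] := min_tensor_rankP X; apply/(rank_eq0 hr).
- move=> X; split=> [X1|X1].
    by have [r hr] := min_tensor_rankP X; rewrite X1 => /(rank_eq1 hr).
  by have [r hr <-] := min_tensor_rankP X; apply/(rank_eq1 hr).
- move=> m n hm hn m2.
  by have [r hr <-] := min_tensor_rankP (AnyTensor hm hn (identity_tensor R m n));
    exact: rank_identity.
- move=> m n hm hn X A n1 XA.
  by have [r hr <-] := min_tensor_rankP (AnyTensor hm hn X); exact: rank_matrix.
- by move=> X a a0; apply: min_tensor_rank_cst => r hr; exact: rank_scale.
- move=> m n s hm hn hns X Y XY; apply: min_tensor_rank_cst => r hr.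
  exact: rank_permute.
- move=> m n hm hn X T hT; apply: min_tensor_rank_homo => r hr.
  exact: rank_subtensor.
Qed.

End TensorRank.

Theorem theorem2p3 (R : realType) :
  exists! r : any_tensor R -> nat,
    tensor_rank_function r /\
    forall r' : any_tensor R -> nat, tensor_rank_function r' ->
      forall X : any_tensor R, (r X <= r' X)%N.
Proof.
exists (@min_tensor_rank R); split.
  split; first exact: min_tensor_rank_tensor_rank.
  by move=> r hr X; exact: min_tensor_rank_le.
(* Two least tensor rank functions bound each other pointwise. *)
move=> r [hr r_le]; apply/funext => X; apply/eqP.
by rewrite eqn_leq min_tensor_rank_le //= r_le //; exact: min_tensor_rank_tensor_rank.
Qed.
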